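(* Let $(T_1,T_2)$ be a pair of doubly twisted contractions on a complex Hilbert space $\mathcal{H}$. Then there is a unique orthogonal decomposition $$\mathcal{H}=\mathcal{H}_{uu}\oplus\mathcal{H}_{u\neg u}\oplus\mathcal{H}_{\neg uu}\oplus\mathcal{H}_{\neg u\neg u},$$ where $\mathcal{H}_{uu},\mathcal{H}_{u\neg u},\mathcal{H}_{\neg uu},\mathcal{H}_{\neg u\neg u}$ are closed subspaces reducing both $T_1$ and $T_2$ such that - $T_1|_{\mathcal{H}_{uu}}$ and $T_2|_{\mathcal{H}_{uu}}$ are unitary; - $T_1|_{\mathcal{H}_{u\neg u}}$ is unitary and $T_2|_{\mathcal{H}_{u\neg u}}$ is completely non-unitary; - $T_1|_{\mathcal{H}_{\neg uu}}$ is completely non-unitary and $T_2|_{\mathcal{H}_{\neg uu}}$ is unitary; - $T_1|_{\mathcal{H}_{\neg u\neg u}}$ and $T_2|_{\mathcal{H}_{\neg u\neg u}}$ are completely non-unitary. Moreover, these subspaces are given by $$\mathcal{H}_{uu}=\bigcap_{m_2\in\mathbb{Z}_+}\big[\mathcal{N}((I-T_2^{*m_2}T_2^{m_2})|_{\mathcal{H}_u^1})\cap\mathcal{N}((I-T_2^{m_2}T_2^{*m_2})|_{\mathcal{H}_u^1})\big],$$ $$\mathcal{H}_{u\neg u}=\bigvee_{m_2\in\mathbb{Z}_+}\big\{(I-T_2^{*m_2}T_2^{m_2})\mathcal{H}_u^1\cup(I-T_2^{m_2}T_2^{*m_2})\mathcal{H}_u^1\big\},$$ $$\mathcal{H}_{\neg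 uu}=\bigcap_{m_2\in\mathbb{Z}_+}\big[\mathcal{N}((I-T_2^{*m_2}T_2^{m_2})|_{\mathcal{H}_{\neg u}^1})\cap\mathcal{N}((I-T_2^{m_2}T_2^{*m_2})|_{\mathcal{H}_{\neg u}^1})\big],$$ $$\mathcal{H}_{\neg u\neg u}=\bigvee_{m_2\in\mathbb{Z}_+}\big\{(I-T_2^{*m_2}T_2^{m_2})\mathcal{H}_{\neg u}^1\cup(I-T_2^{m_2}T_2^{*m_2})\mathcal{H}_{\neg u}^1\big\},$$ where $$\mathcal{H}_u^1=\bigcap_{m_1\in\mathbb{Z}_+}\big[\mathcal{N}(I-T_1^{*m_1}T_1^{m_1})\cap\mathcal{N}(I-T_1^{m_1}T_1^{*m_1})\big],$$ $$\mathcal{H}_{\neg u}^1=\bigvee_{m_1\in\mathbb{Z}_+}\big\{\mathcal{R}(I-T_1^{*m_1}T_1^{m_1})\cup\mathcal{R}(I-T_1^{m_1}T_1^{*m_1})\big\}.$$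
   Context: $\mathcal{H}$ is a complex Hilbert space, $I$ the identity operator, $\mathbb{Z}_+=\{0,1,2,\ldots\}$. $\mathcal{N}(T)$ and $\mathcal{R}(T)$ are the kernel and range of $T$; $\bigvee\mathcal{M}$ is the closed linear span of $\mathcal{M}$. For a closed subspace $\mathcal{M}$, $S|_{\mathcal{M}}$ is the restriction of $S$ to $\mathcal{M}$, so $\mathcal{N}(S|_{\mathcal{M}})=\mathcal{M}\cap\mathcal{N}(S)$. A closed subspace $\mathcal{M}$ reduces $T$ if $T\mathcal{M}\subseteq\mathcal{M}$ and $T\mathcal{M}^\perp\subseteq\mathcal{M}^\perp$. A contraction is an operator $T$ with $\|Th\|\le\|h\|$ for all $h$. A contraction is completely non-unitary if there is no nonzero reducing subspace on which its restriction is unitary. Any of the four subspaces may be $\{0\}$. A pair of doubly twisted contractions (also called a $\mathcal{U}_2$-twisted contraction) on $\mathcal{H}$ is a pair $(T_1,T_2)$ of contractions for which there is a unitary $U$ on $\mathcal{H}$ (the twist) with $$T_1T_2=UT_2T_1,\qquad T_1^*T_2=U^*T_2T_1^*,\qquad T_1U=UT_1,\quad T_2U=UT_2.$$ *)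

(* Defs.v *)
From HB Require Import structures.
From mathcomp Require Import all_boot all_order all_algebra.
From mathcomp Require Import all_classical all_reals all_analysis.
From mathcomp Require Import complex.

Set Implicit Arguments.
Unset Strict Implicit.
Unset Printing Implicit Defensive.

Import Order.TTheory GRing.Theory Num.Theory.
Import numFieldNormedType.Exports.

Local Open Scope classical_set_scope.
Local Open Scope ring_scope.

(* A complex Hilbert space is a Banach space [H] over [R[i]] together with an
   inner product [dot] (linear on the left, conjugate-linear on the right)
   that induces its norm. *)
Definition induces_norm (R : realType) (H : completeNormedModType R[i])
    (dot : {dot H for Num.conj}) : Prop :=
  forall h : H, `|h| ^+ 2 = dot h h.

Section Operators.
Context (R : realType) (H : completeNormedModType R[i]).
Context (dot : {dot H for Num.conj}).
Implicit Types (M N A : set H) (T U : {linear H -> H}) (F : H -> H).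

Definition closed_subspace M : Prop :=
  [/\ M 0, (forall (a : R[i]) x y, M x -> M y -> M (a *: x + y)) & closed M].

Definition closed_span A : set H := smallest closed_subspace A.

Definition orthocompl_in M N : set H :=
  [set x | M x /\ forall y, N y -> dot x y = 0].

(* An operator on a closed subspace [M] is represented by a linear map of [H]
   that maps [M] into itself; only its values on [M] matter. The notions below
   are those of the restriction [T|_M] as an operator on the Hilbert space [M];
   [M = setT] gives the notions for [T] on [H]. *)
Definition stable M T : Prop := T @` M `<=` M.

Definition contraction_on M T : Prop :=
  stable M T /\ forall h, M h -> `|T h| <= `|h|.

(* [adjoint_on M T y] is the unique [z] in [M] such that <T x, y> = <x, z> for
   all [x] in [M]; it exists, by the Riesz theorem, when [M] is a closed
   subspace, [y] is in [M] and [T|_M] is a bounded operator on [M]. The value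
   is 0 if there is no such [z]. *)
Definition adjoint_on M T (y : H) : H :=
  xget 0 [set z | M z /\ forall x, M x -> dot (T x) y = dot x z].

(* Boundedness is not required separately: the two equations can only hold if
   [T|_M] has an everywhere defined adjoint. *)
Definition unitary_on M T : Prop :=
  stable M T /\
  forall h, M h -> adjoint_on M T (T h) = h /\ T (adjoint_on M T h) = h.

Definition reduces_in M T N : Prop :=
  [/\ closed_subspace N, N `<=` M, stable N T
    & stable (orthocompl_in M N) T].

Definition cnu_on M T : Prop :=
  contraction_on M T /\
  forall N, reduces_in M T N -> unitary_on N T -> N = [set 0].

Definition adjoint T : H -> H := adjoint_on setT T.
Definition contraction T : Prop := contraction_on setT T.
Definition unitary T : Prop := unitary_on setT T.
Definition reduces T N : Prop := reduces_in setT T N.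

Definition reduces_both T1 T2 N : Prop := reduces T1 N /\ reduces T2 N.

Definition twist T1 T2 U : Prop :=
  [/\ forall h, T1 (T2 h) = U (T2 (T1 h)),
      forall h, adjoint T1 (T2 h) = adjoint U (T2 (adjoint T1 h)),
      forall h, T1 (U h) = U (T1 h)
    & forall h, T2 (U h) = U (T2 h)].

Definition doubly_twisted T1 T2 : Prop :=
  [/\ contraction T1, contraction T2 & exists U, unitary U /\ twist T1 T2 U].

(* I - T^{*m} T^m  and  I - T^m T^{*m} *)
Definition defect T (m : nat) : H -> H :=
  fun h => h - iter m (adjoint T) (iter m T h).
Definition codefect T (m : nat) : H -> H :=
  fun h => h - iter m T (iter m (adjoint T) h).

(* kernel of the restriction of [F] to [M] *)
Definition ker_on M F : set H := [set h | M h /\ F h = 0].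

Definition unitary_part M T : set H :=
  \bigcap_(m in [set: nat]) (ker_on M (defect T m) `&` ker_on M (codefect T m)).

Definition cnu_part M T : set H :=
  closed_span
    (\bigcup_(m in [set: nat]) (defect T m @` M `|` codefect T m @` M)).

Definition orthogonal_subspaces M N : Prop :=
  forall x y, M x -> N y -> dot x y = 0.

Definition orthogonal_decomposition (M1 M2 M3 M4 : set H) : Prop :=
  [/\ [/\ closed_subspace M1, closed_subspace M2,
          closed_subspace M3 & closed_subspace M4],
      [/\ orthogonal_subspaces M1 M2, orthogonal_subspaces M1 M3
        & orthogonal_subspaces M1 M4],
      [/\ orthogonal_subspaces M2 M3, orthogonal_subspaces M2 M4
        & orthogonal_subspaces M3 M4]
    & forall h, exists x1 x2 x3 x4,
        [/\ M1 x1, M2 x2, M3 x3 & M4 x4] /\ h = x1 + x2 + x3 + x4].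

(* u = unitary, n = completely non-unitary; the first letter is for [T1] *)
Definition canonical_decomposition T1 T2 (Huu Hun Hnu Hnn : set H) : Prop :=
  [/\ orthogonal_decomposition Huu Hun Hnu Hnn,
      [/\ reduces_both T1 T2 Huu, reduces_both T1 T2 Hun,
          reduces_both T1 T2 Hnu & reduces_both T1 T2 Hnn]
    & [/\ unitary_on Huu T1 /\ unitary_on Huu T2,
          unitary_on Hun T1 /\ cnu_on Hun T2,
          cnu_on Hnu T1 /\ unitary_on Hnu T2
        & cnu_on Hnn T1 /\ cnu_on Hnn T2]].

End Operators.

(* Main.v *)
Require Import Defs.
From mathcomp Require Import all_boot all_order all_algebra.
From mathcomp Require Import all_classical all_reals all_analysis.
From mathcomp Require Import complex ring lra.

(** For a contraction [T], the vectors [h] that are fixed by all [T^{*m} T^m]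
    and all [T^m T^{*m}] form a closed subspace [core T], a local
    notation for [unitary_part dot setT T], that reduces [T]; it is the largest
    reducing subspace on which [T] is unitary. Every subspace [M] that reduces
    [T] splits along [core T] and its orthogonal complement: [T] is unitary on
    [M] iff [M] lies in [core T] ([unitary_on_core]), and [T] is completely
    non-unitary on [M] iff [M] is orthogonal to [core T] ([cnu_on_core]).
    Because the defect operators [I - T^{*m} T^m] and [I - T^m T^{*m}] are
    self-adjoint, the closed span of their ranges is the orthogonal complement
    of the intersection of their kernels; this identifies the two explicit
    formulas with the two intersections ([unitary_partE], [cnu_partE]).

    The twist enters only once. Moving [T2] through [T1^m] costs a factor
    [U^m], moving it through [T1^{*m}] costs [U^{*m}], and in a defect operator
    of [T1] the two factors cancel. So [T2] and [T2^*] commute with the defect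
    operators of [T1], and [core T1] reduces [T2]; the relations are symmetric
    in the two operators, with [U^*] as twist after the exchange, so [core T2]
    reduces [T1] ([doubly_twisted_core]). The four summands are then the
    intersections of [core T1] or its complement with [core T2] or its
    complement. They span, because the projection onto a subspace that reduces
    [T] preserves [core T] and its complement ([core_split],
    [perp_core_split]).

    For uniqueness, the two characterizations place each summand of another
    decomposition inside the corresponding intersection, and an orthogonal
    decomposition that is contained termwise in another one is equal to it
    ([orthogonal_decomposition_eq]).

    The geometry of Hilbert spaces that this needs, namely orthogonal
    projections, the Riesz representation and adjoints of contractions, is
    developed from the completeness of the norm. *)

Import Order.TTheory GRing.Theory Num.Theory.
Import numFieldNormedType.Exports.
Local Open Scope classical_set_scope.
Local Open Scope ring_scope.

(** * Iterates of operators that commute up to a twist *)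

Lemma iter_commute (X : Type) (F V : X -> X) m k x :
  (forall y, F (V y) = V (F y)) -> iter m F (iter k V x) = iter k V (iter m F x).
Proof.
move=> FV; elim: m => // m IHm; rewrite !iterS IHm.
by elim: k (iter m F x) {IHm} => // k IHk y; rewrite !iterS FV IHk.
Qed.

Lemma iter_twisted (X : Type) (A B V : X -> X) m x :
    (forall y, A (B y) = V (B (A y))) -> (forall y, A (V y) = V (A y)) ->
  iter m A (B x) = iter m V (B (iter m A x)).
Proof.
move=> AB AV; elim: m => // m IHm.
by rewrite iterS IHm -[LHS]/(iter 1 A _) iter_commute//= AB -iterSr iterS.
Qed.

(** [C] undoes the twist that [A] introduces. With [A = T1], [C = T1^*],
    [B = T2] this says that [T2] commutes with [T1^{*m} T1^m]; exchanging [A]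
    with [C] and [V] with [V'] gives [T1^m T1^{*m}]. *)
Lemma iter_untwist (X : Type) (A C B V V' : X -> X) m x :
    (forall y, A (B y) = V (B (A y))) -> (forall y, C (B y) = V' (B (C y))) ->
    (forall y, A (V y) = V (A y)) -> (forall y, C (V y) = V (C y)) ->
    (forall y, C (V' y) = V' (C y)) -> cancel V' V ->
  iter m C (iter m A (B x)) = B (iter m C (iter m A x)).
Proof.
move=> AB CB AV CV CV' V'K; rewrite (iter_twisted _ A B V)// iter_commute//.
rewrite (iter_twisted _ C B V')//; elim: m (B _) => // m IHm y.
by rewrite iterSr [iter m.+1 V' _]iterS V'K IHm.
Qed.

(** * Inner product and orthogonal projections *)

Section InnerProduct.
Context {R : realType} {H : completeNormedModType R[i]}.
Context (dot : {dot H for Num.conj}) (Hdot : induces_norm dot).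
Implicit Types (x y z h : H) (M N : set H).

Let dotDl x y z : dot (x + y) z = dot x z + dot y z.
Proof. exact: linearDl. Qed.

Let dotBl x y z : dot (x - y) z = dot x z - dot y z.
Proof. exact: linearBl. Qed.

Let dotZl a x y : dot (a *: x) y = a * dot x y.
Proof. by rewrite linearZl_LR. Qed.

Let dotDr x y z : dot x (y + z) = dot x y + dot x z.
Proof. exact: linearDr. Qed.

Let dotBr x y z : dot x (y - z) = dot x y - dot x z.
Proof. exact: linearBr. Qed.

Let dotZr a x y : dot x (a *: y) = Num.conj a * dot x y.
Proof. by rewrite linearZr_LR. Qed.

Let dotC x y : dot x y = Num.conj (dot y x).
Proof. by rewrite hermC /= expr0 mul1r. Qed.

Lemma dot_eq0C x y : dot x y = 0 -> dot y x = 0.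
Proof. by move=> xy; rewrite dotC xy conjC0. Qed.

Lemma dot_eq0 x : dot x x = 0 -> x = 0.
Proof. by move=> /eqP; rewrite dnorm_eq0 => /eqP. Qed.

Lemma dot_injr x y : (forall z, dot z x = dot z y) -> x = y.
Proof.
move=> xy; apply/eqP; rewrite -subr_eq0; apply/eqP/dot_eq0.
by rewrite dotBr xy subrr.
Qed.

Lemma cauchy_schwarz x y : `|dot x y| <= `|x| * `|y|.
Proof.
have [->|y0] := eqVneq y 0; first by rewrite linear0r !normr0 mulr0.
(* [x = a *: y + r] with [r] orthogonal to [y], and Pythagoras *)
have yy0 : dot y y != 0 by rewrite dnorm_eq0.
pose a := dot x y / dot y y; pose r := x - a *: y.
have ry : dot r y = 0 by rewrite /r dotBl dotZl divfK// subrr.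
have xE : x = a *: y + r by rewrite /r addrC subrK.
have xyE : dot x y = a * dot y y by rewrite xE dotDl dotZl ry addr0.
rewrite -(@ler_pXn2r _ 2)// ?nnegrE ?mulr_ge0// exprMn !Hdot xyE normrM exprMn.
rewrite (ger0_norm (dnorm_ge0 _ _)) expr2 mulrA ler_wpM2r//.
clearbody r a.
have yr : dot y r = 0 by exact: dot_eq0C.
rewrite [in leRHS]xE dotDl !dotDr !dotZl !dotZr ry yr !mulr0 addr0 add0r.
by rewrite mulrA -normCK lerDl.
Qed.

(** Norms are elements of [R[i]], whose order is only partial; infima and
    arithmetic decision procedures need their values in [R]. *)
Definition rnorm x : R := complex.Re `|x|.

Lemma rnormE x : `|x| = (rnorm x)%:C%C.
Proof. by rewrite /rnorm RRe_real// normr_real. Qed.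

Lemma rnorm_ge0 x : 0 <= rnorm x.
Proof. by have := normr_ge0 x; rewrite rnormE lecR. Qed.

Lemma rnorm_le x y : (`|x| <= `|y|) = (rnorm x <= rnorm y).
Proof. by rewrite !rnormE lecR. Qed.

Lemma rnormD x y : rnorm (x + y) <= rnorm x + rnorm y.
Proof. by have := ler_normD x y; rewrite !rnormE -rmorphD lecR. Qed.

Lemma rnorm_sqr x : ((rnorm x) ^+ 2)%:C%C = dot x x.
Proof. by rewrite -Hdot rnormE rmorphXn. Qed.

Lemma parallelogram x y :
  rnorm (x + y) ^+ 2 + rnorm (x - y) ^+ 2 = 2 * rnorm x ^+ 2 + 2 * rnorm y ^+ 2.
Proof.
apply: (@complexI R); rewrite !rmorphD/= !(rmorphM _ (2 : R))/= !rnorm_sqr rmorph_nat.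
rewrite dotDl dotBl !dotBr !dotDr; ring.
Qed.

Lemma rnormBC x y : rnorm (x - y) = rnorm (y - x).
Proof. by rewrite /rnorm distrC. Qed.

Lemma rnormZ2 x : rnorm (2 *: x) = 2 * rnorm x.
Proof.
apply: (@complexI R); rewrite -rnormE normrZ rnormE rmorphM/= normr_nat.
by rewrite rmorph_nat.
Qed.

Lemma closed_approx M x : closed M ->
  (forall e : R, 0 < e -> exists2 y, M y & rnorm (x - y) < e) -> M x.
Proof.
move=> cM happ; apply: cM => B /nbhs_normP[e /= e0 eB].
have eE : e = (complex.Re e)%:C%C by rewrite RRe_real// gtr0_real.
have [|y My xy] := happ (complex.Re e); first by rewrite -ltcR -eE.
by exists y; split=> //; apply: eB; rewrite /ball_/= rnormE eE ltcR.
Qed.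

Lemma cauchy_filter_limit (F : set (set H)) : ProperFilter F ->
  (forall e : R, 0 < e -> exists2 A : set H, F A &
     forall x y, A x -> A y -> rnorm (x - y) < e) ->
  exists p, forall (e : R) A, 0 < e -> F A -> exists2 y, A y & rnorm (p - y) < e.
Proof.
move=> FF Fcauchy; have /cauchy_cvg : cauchy F.
  apply/cauchy_ballP => e e0; rewrite -ball_normE.
  have eE : e = (complex.Re e)%:C%C by rewrite RRe_real// gtr0_real.
  have [|A FA dA] := Fcauchy (complex.Re e); first by rewrite -ltcR -eE.
  exists (A, A) => //= -[x y] /= [Ax Ay].
  by rewrite rnormE eE ltcR; exact: dA.
move=> Fcvg; exists (lim F) => e A e0 FA.
have : F [set y | rnorm (lim F - y) < e].
  apply: Fcvg; apply/nbhs_normP; exists e%:C%C; first by rewrite /= ltcR.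
  by move=> y; rewrite /ball_/= rnormE ltcR.
by move=> /(filterI FA)/filter_ex [y [Ay yp]]; exists y.
Qed.

(** By the parallelogram law, points of [M] whose squared distance to [h]
    exceeds the infimum by at most [e] are within [2 * sqrt e] of each other,
    so the sets of near minimizers generate a Cauchy filter; its limit is the
    closest point. *)
Lemma closest_point M h : closed_subspace M ->
  exists2 p, M p & forall y, M y -> rnorm (h - p) <= rnorm (h - y).
Proof.
move=> [M0 Mlin cM].
pose E := [set rnorm (h - y) ^+ 2 | y in M].
have E_inf : has_inf E.
  by split; [exists (rnorm (h - 0) ^+ 2), 0|exists 0 => _ [y _ <-]; rewrite sqr_ge0].
have inf_le y : M y -> inf E <= rnorm (h - y) ^+ 2.
  by move=> My; apply: ge_inf; [exact: E_inf.2|exists y].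
pose near_inf (e : R) := [set y | M y /\ rnorm (h - y) ^+ 2 < inf E + e].
have near_inf0 e : 0 < e -> near_inf e !=set0.
  by move=> /(inf_adherent)/(_ E_inf) [_ [y My <-] ye]; exists y.
pose F := filter_from [set e : R | 0 < e] near_inf.
have FF : ProperFilter F.
  apply: filter_from_proper; last by move=> e /near_inf0.
  apply: filter_from_filter; first by exists 1 => /=.
  move=> e1 e2 /= e1_gt0 e2_gt0; exists (Num.min e1 e2) => /=.
    by rewrite lt_min e1_gt0.
  by move=> y [My]; rewrite -ltrBlDl lt_min !ltrBlDl => /andP[y1 y2].
have [e e0|p Hp] := cauchy_filter_limit _ FF.
  exists (near_inf (e ^+ 2 / 4)).
    by exists (e ^+ 2 / 4) => //=; rewrite divr_gt0// exprn_gt0.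
  move=> x y [Mx hx] [My hy].
  rewrite -(@ltr_pXn2r _ 2)// ?nnegrE ?rnorm_ge0 ?(ltW e0)//.
  have := parallelogram (h - x) (h - y).
  have -> : h - x - (h - y) = y - x by rewrite opprB addrC addrA subrK.
  have -> : h - x + (h - y) = 2 *: (h - 2^-1 *: (x + y)).
    rewrite scalerBr scalerA divff ?pnatr_eq0// scale1r.
    by rewrite scaler_nat mulr2n addrACA opprD.
  have /inf_le : M (2^-1 *: (x + y)).
    rewrite -[_ *: _]addr0; apply: (Mlin) => //.
    by rewrite -[x]scale1r; exact: Mlin.
  rewrite rnormZ2 (rnormBC y x) exprMn; lra.
have Mp : M p.
  apply: closed_approx => // e e0.
  have [|y [My _] ?] := Hp e (near_inf 1) e0; first by exists 1 => /=.
  by exists y.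
exists p => // y My; rewrite leNgt; apply/negP => lt_yp.
(* a near minimizer [z] within [g / 2] of [p] makes [rnorm (h - p)] strictly
   smaller than [rnorm (h - y) + g], which is [rnorm (h - p)] itself *)
pose g := rnorm (h - p) - rnorm (h - y).
have g0 : 0 < g / 2 by rewrite divr_gt0// subr_gt0.
have [|z [Mz hz] pz] := Hp (g / 2) (near_inf ((g / 2) ^+ 2)) g0.
  by exists ((g / 2) ^+ 2) => //=; rewrite exprn_gt0.
have : rnorm (h - z) < rnorm (h - y) + g / 2.
  rewrite -(@ltr_pXn2r _ 2)// ?nnegrE ?addr_ge0 ?rnorm_ge0 ?(ltW g0)//.
  have := inf_le y My; have := rnorm_ge0 (h - y); nra.
have := rnormD (h - z) (z - p); rewrite addrA subrK (rnormBC z).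
rewrite /g in pz *; lra.
Qed.

(** If [h - p] had a component [a *: y] along [y] in [M], then [p + a *: y]
    would be closer to [h] than the closest point [p]. *)
Lemma orthogonal_projection M h : closed_subspace M ->
  exists2 p, M p & forall y, M y -> dot (h - p) y = 0.
Proof.
move=> cM; have [M0 Mlin _] := cM.
have [p Mp pmin] := closest_point M h cM; exists p => // y My.
have [->|y0] := eqVneq y 0; first by rewrite linear0r.
have yy0 : dot y y != 0 by rewrite dnorm_eq0.
pose a := dot (h - p) y / dot y y; pose r := h - p - a *: y.
have ry : dot r y = 0 by rewrite /r dotBl dotZl divfK// subrr.
have yr : dot y r = 0 by exact: dot_eq0C.
have hpE : h - p = a *: y + r by rewrite /r [RHS]addrC subrK.
have hpy : dot (h - p) y = a * dot y y by rewrite divfK.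
have : `|h - p| ^+ 2 <= `|r| ^+ 2.
  rewrite ler_pXn2r ?nnegrE// rnorm_le.
  have -> : r = h - (a *: y + p) by rewrite /r opprD addrA addrAC.
  by apply: pmin; exact: Mlin.
rewrite hpy !Hdot hpE; clearbody r a.
rewrite !dotDl !dotDr !dotZl !dotZr ry yr !mulr0 !addr0 add0r.
rewrite gerDr mulrA -normCK pmulr_lle0; last by rewrite dnorm_gt0.
move=> a2; have /eqP : `|a| ^+ 2 = 0 by apply/eqP; rewrite eq_le a2 exprn_ge0.
by rewrite expf_eq0/= normr_eq0 => /eqP ->; rewrite mul0r.
Qed.

(** * Bounded functionals and closed subspaces *)

Section BoundedFunctional.
Context (f : H -> R[i]) (f_lin : forall a x y, f (a *: x + y) = a * f x + f y).
Context (f_bnd : exists C : R, forall x, `|f x| <= C%:C%C * `|x|).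

Let f0 : f 0 = 0.
Proof.
by have := f_lin 1 0 0; rewrite scale1r addr0 mul1r -[LHS]addr0 => /addrI <-.
Qed.

Let fB x y : f (x - y) = f x - f y.
Proof. by rewrite addrC -scaleN1r f_lin mulN1r addrC. Qed.

Lemma functional_ker_closed : closed_subspace [set x | f x = 0].
Proof.
split=> /= [|a x y fx fy|x clx]; [exact: f0| |].
  by rewrite f_lin fx fy mulr0 addr0.
have [C fC] := f_bnd.
apply/eqP; rewrite -normr_eq0 eq_le normr_ge0 andbT; apply/ler_addgt0Pl => e e0.
have eE : e = (complex.Re e)%:C%C by rewrite RRe_real// gtr0_real.
have d0 : 0 < e / (`|C| + 1)%:C%C by rewrite divr_gt0// ltcR ltr_wpDl.
have [y [/= fy xy]] := clx _ (nbhsx_ballx x _ d0).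
rewrite addr0 -[f x]subr0 -fy -fB (le_trans (fC _))//.
rewrite (@le_trans _ _ ((`|C| + 1)%:C%C * `|x - y|))//.
  by rewrite ler_wpM2r// lecR (le_trans (ler_norm C))// lerDl.
rewrite mulrC -ler_pdivlMr ?ltcR ?ltr_wpDl//.
by move: xy; rewrite -ball_normE => /ltW.
Qed.

(** A nonzero [r] orthogonal to the kernel of [f] spans its complement, so [f]
    is a multiple of [dot _ r]. *)
Lemma riesz : exists z, forall x, f x = dot x z.
Proof.
have [f_eq0|] := pselect (forall x, f x = 0).
  by exists 0 => x; rewrite f_eq0 linear0r.
move=> /existsNP[h /eqP fh].
have [p fp r_perp] := orthogonal_projection _ h functional_ker_closed.
pose r := h - p; have fr : f r != 0 by rewrite /r fB fp subr0.
have rr : dot r r != 0.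
  by rewrite dnorm_eq0; apply: contra_neq fr => ->.
exists (Num.conj (f r / dot r r) *: r) => x.
rewrite dotZr conjCK.
have : dot (x - (f x / f r) *: r) r = 0.
  by apply/dot_eq0C/r_perp; rewrite /= addrC -scaleNr f_lin mulNr divfK// addNr.
rewrite dotBl dotZl => /subr0_eq ->.
by field; rewrite fr.
Qed.
End BoundedFunctional.

Lemma dot_injl x y : (forall z, dot x z = dot y z) -> x = y.
Proof. by move=> xy; apply: dot_injr => z; rewrite dotC xy -dotC. Qed.

Section Subspace.
Context M (cM : closed_subspace M).

Lemma subspace0 : M 0.
Proof. by case: cM. Qed.

Lemma subspaceB x y : M x -> M y -> M (x - y).
Proof.
by case: cM => _ Mlin _ Mx My; rewrite addrC -scaleN1r; exact: Mlin.
Qed.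
End Subspace.

Lemma closed_subspaceI M N :
  closed_subspace M -> closed_subspace N -> closed_subspace (M `&` N).
Proof.
move=> [M0 Ml Mc] [N0 Nl Nc]; split=> //; last exact: closedI.
by move=> a x y [Mx Nx] [My Ny]; split; [exact: Ml|exact: Nl].
Qed.

Lemma closed_subspaceT : closed_subspace [set: H].
Proof. by split=> //; exact: closedT. Qed.

Local Notation perp := (orthocompl_in dot setT).

Lemma perp_closed_subspace N : closed_subspace (perp N).
Proof.
have -> : perp N = \bigcap_(y in N) [set x | dot x y = 0].
  apply/seteqP; split=> [x [_ xN] y Ny|x xN]; first exact: xN.
  by split=> // y Ny; exact: xN.
have ker y : closed_subspace [set x | dot x y = 0].
  apply: (functional_ker_closed (dot ^~ y)) => [a u v|].
    by rewrite dotDl dotZl.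
  by exists (rnorm y) => x; rewrite -rnormE mulrC; exact: cauchy_schwarz.
split=> [y Ny|a u v Nu Nv y Ny|]; first exact: (subspace0 _ (ker y)).
- by have [_ lin _] := ker y; apply: lin; [exact: Nu|exact: Nv].
- by apply: closed_bigI => y Ny; have [] := ker y.
Qed.

(** * Adjoints *)

(** Kept for plain functions so that the lemmas apply to a contraction, its
    adjoint, their iterates and the defect operators alike. *)
Definition adjoint_pair (F G : H -> H) := forall x y, dot (F x) y = dot x (G y).

Section AdjointPair.
Context (F G : H -> H) (FG : adjoint_pair F G).

Lemma adjoint_pair_sym : adjoint_pair G F.
Proof. by move=> x y; rewrite dotC -FG -dotC. Qed.

Lemma adjoint_pair_linear a x y : F (a *: x + y) = a *: F x + F y.
Proof. by apply: dot_injl => z; rewrite dotDl dotZl !FG dotDl dotZl. Qed.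

Lemma adjoint_pairB x y : F (x - y) = F x - F y.
Proof. by rewrite addrC -scaleN1r adjoint_pair_linear scaleN1r addrC. Qed.

Lemma adjoint_pair_iter m : adjoint_pair (iter m F) (iter m G).
Proof. by elim: m => // m IHm x y; rewrite iterS FG IHm -iterSr. Qed.

(** [|G x|^2 = <F (G x), x>] is at most [|G x| |x|]. *)
Lemma adjoint_pair_contraction :
  (forall x, rnorm (F x) <= rnorm x) -> forall x, rnorm (G x) <= rnorm x.
Proof.
move=> Fle x; have [->|] := eqVneq (rnorm (G x)) 0; first exact: rnorm_ge0.
move=> Gx0; have Gx_gt0 : 0 < rnorm (G x) by rewrite lt_def Gx0 rnorm_ge0.
rewrite -(ler_pM2l Gx_gt0) -lecR -expr2 rnorm_sqr -FG rmorphM/= -!rnormE.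
rewrite -[leLHS]ger0_norm ?FG// -FG (le_trans (cauchy_schwarz _ _))//.
by rewrite ler_wpM2r// rnorm_le.
Qed.

(** Expanding [|G (F x) - x|^2] gives [|G (F x)|^2 - 2 |F x|^2 + |x|^2], which
    is at most [2 |x|^2 - 2 |F x|^2]. *)
Lemma adjoint_pair_isometric x :
  (forall y, rnorm (F y) <= rnorm y) -> rnorm x <= rnorm (F x) -> G (F x) = x.
Proof.
move=> Fle xF; apply/eqP; rewrite -subr_eq0; apply/eqP/dot_eq0.
have GFle : rnorm (G (F x)) <= rnorm x.
  exact: le_trans (adjoint_pair_contraction Fle (F x)) (Fle x).
apply/eqP; rewrite eq_le dnorm_ge0 andbT.
rewrite dotBl !dotBr -(FG x) (adjoint_pair_sym _ x) -!rnorm_sqr.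
rewrite -!rmorphB/= lecR; have := rnorm_ge0 x; have := rnorm_ge0 (G (F x)); nra.
Qed.

Lemma adjoint_pair_defect : adjoint_pair (fun x => x - G (F x)) (fun x => x - G (F x)).
Proof. by move=> x y; rewrite dotBl dotBr adjoint_pair_sym FG. Qed.

End AdjointPair.

Lemma adjoint_onE M (T : {linear H -> H}) y z : closed_subspace M -> M z ->
  (forall x, M x -> dot (T x) y = dot x z) -> adjoint_on dot M T y = z.
Proof.
move=> cM Mz Tz; apply: xget_unique => // w [Mw Tw].
have Mzw : M (w - z) by exact: subspaceB.
by apply/subr0_eq/dot_eq0; rewrite dotBr -Tw// -Tz// subrr.
Qed.

(** [adjoint_on] has a meaningful value as soon as [T] is unitary on [M]: if no
    adjoint vector of [y] existed, the default value 0 would give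
    [y = T 0 = 0], for which 0 is an adjoint vector. *)
Lemma unitary_on_adjoint M (T : {linear H -> H}) y :
    M 0 -> unitary_on dot M T -> M y ->
  M (adjoint_on dot M T y) /\
  forall x, M x -> dot (T x) y = dot x (adjoint_on dot M T y).
Proof.
move=> M0 [_ TK] My; rewrite /adjoint_on; case: xgetP => [z _ [Mz Tz] //|no_adj].
have y0 : y = 0.
  by have [_] := TK y My; rewrite /adjoint_on xgetPN ?linear0.
by split=> // x Mx; rewrite y0 !linear0r.
Qed.

Lemma adjointP (T : {linear H -> H}) :
  contraction_on setT T -> adjoint_pair T (adjoint dot T).
Proof.
move=> [_ Tle] x y; rewrite /adjoint /adjoint_on.
have [||z Tz] := riesz (fun x => dot (T x) y).
- by move=> a u v; rewrite linearP dotDl dotZl.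
- exists (rnorm y) => u; rewrite -rnormE mulrC (le_trans (cauchy_schwarz _ _))//.
  by rewrite ler_wpM2r// Tle.
have : [set z | setT z /\ forall x, setT x -> dot (T x) y = dot x z] z by [].
by move=> /(xgetI 0)[_]; exact.
Qed.

(** * Reducing subspaces and the unitary core *)

Local Notation adj := (adjoint dot).
Local Notation core := (unitary_part dot setT).
Implicit Types T : {linear H -> H}.

(** For a contraction this is equivalent to reducing [T] (see [reducesP]);
    unlike stability of the complement, it is visibly closed under
    intersections. *)
Definition biinvariant T M :=
  [/\ closed_subspace M, (forall x, M x -> M (T x))
    & forall x, M x -> M (adj T x)].

Lemma biinvariantT T : biinvariant T setT.
Proof. by split=> //; exact: closed_subspaceT. Qed.

Lemma biinvariantI T M N :
  biinvariant T M -> biinvariant T N -> biinvariant T (M `&` N).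
Proof.
move=> [cM MT MA] [cN NT NA]; split; first exact: closed_subspaceI.
  by move=> x [/MT Mx /NT Nx].
by move=> x [/MA Mx /NA Nx].
Qed.

Lemma unitary_partP M T h : unitary_part dot M T h <->
  M h /\ forall m, iter m (adj T) (iter m T h) = h /\
                   iter m T (iter m (adj T) h) = h.
Proof.
split=> [Uh|[Mh Uh] m _].
  split=> [|m]; first by have [[]] := Uh 0%N I.
  by have [[_ /subr0_eq <-] [_ /subr0_eq <-]] := Uh m I.
have [d c] := Uh m.
by split; split=> //; rewrite ?/defect ?/codefect ?d ?c subrr.
Qed.

Lemma unitary_partE M T : unitary_part dot M T = M `&` core T.
Proof.
apply/seteqP; split=> h.
  by move=> /unitary_partP[Mh Uh]; split=> //; apply/unitary_partP.
by move=> [Mh /unitary_partP[_ Uh]]; apply/unitary_partP.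
Qed.

Section Contraction.
Context T (cT : contraction_on setT T).

Let TA : adjoint_pair T (adj T).
Proof. exact: adjointP. Qed.

Let AT : adjoint_pair (adj T) T.
Proof. exact: adjoint_pair_sym. Qed.

Let T_le x : rnorm (T x) <= rnorm x.
Proof. by case: cT => _ Tle; rewrite -rnorm_le Tle. Qed.

Let A_le x : rnorm (adj T x) <= rnorm x.
Proof. exact: adjoint_pair_contraction TA T_le x. Qed.

Let iter_le (F : H -> H) m x : (forall y, rnorm (F y) <= rnorm y) ->
  rnorm (iter m F x) <= rnorm x.
Proof. by move=> Fle; elim: m => // m IHm; exact: le_trans (Fle _) IHm. Qed.

Let defect_self m : adjoint_pair (defect dot T m) (defect dot T m).
Proof. exact: adjoint_pair_defect (adjoint_pair_iter _ _ TA m). Qed.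

Let codefect_self m : adjoint_pair (codefect dot T m) (codefect dot T m).
Proof. exact: adjoint_pair_defect (adjoint_pair_iter _ _ AT m). Qed.

Lemma perp_biinvariant M : biinvariant T M -> biinvariant T (perp M).
Proof.
move=> [cM MT MA]; split=> [|x [_ xM]|x [_ xM]].
- exact: perp_closed_subspace.
- by split=> // y My; rewrite TA xM//; exact: MA.
- by split=> // y My; rewrite AT xM//; exact: MT.
Qed.

(** Reducing is transitive. If [y] is in [N], the component of [T^* y] in [M]
    orthogonal to [N] vanishes because [T] preserves the complement of [N] in
    [M]. *)
Lemma reduces_in_biinvariant M N : biinvariant T M ->
  reduces_in dot M T N <-> biinvariant T N /\ N `<=` M.
Proof.
move=> [cM MT MA]; split=> [[cN NM NT N'T]|[[cN NT NA] NM]]; last first.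
  split=> // _ [x hx <-]; first exact: NT.
  have [Mx xN] := hx; split; first exact: MT.
  by move=> y Ny; rewrite TA xN//; exact: NA.
split=> //; split=> // [x Nx|y Ny]; first by apply: NT; exists x.
have MAy : M (adj T y) by exact/MA/NM.
have [p Np Ap] := orthogonal_projection N (adj T y) cN.
pose z := adj T y - p.
have N'z : orthocompl_in dot M N z by split; [apply: subspaceB => //; exact: NM|].
suff /subr0_eq -> : adj T y - p = 0 by [].
apply: dot_eq0; rewrite -/z {2}/z dotBr -TA.
have [_ -> //] : orthocompl_in dot M N (T z) by apply: N'T; exists z.
by rewrite (Ap p)// subrr.
Qed.

Lemma reducesP N : reduces dot T N <-> biinvariant T N.
Proof.
rewrite /reduces reduces_in_biinvariant; last exact: biinvariantT.
by split=> [[]|].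
Qed.

(** [D p = - D (h - p)] is in [M] and orthogonal to [M]. *)
Lemma self_adjoint_split (D : H -> H) M h p : adjoint_pair D D ->
    (forall x, M x -> M (D x)) -> M p -> perp M (h - p) -> D h = 0 -> D p = 0.
Proof.
move=> DD MD Mp [_ hp] Dh; apply: dot_eq0.
have DpE : D p = - D (h - p) by rewrite (adjoint_pairB _ _ DD) Dh sub0r opprK.
by rewrite {1}DpE linearNl /= DD hp ?oppr0//; exact/MD/MD.
Qed.

Lemma core_closed : closed_subspace (core T).
Proof.
(* the kernel of a self-adjoint operator is the complement of its range *)
have -> : core T = perp (\bigcup_m (range (defect dot T m) `|` range (codefect dot T m))).
  apply/seteqP; split=> h.
    move=> Uh; split=> // _ [m _ [[x _ <-]|[x _ <-]]].
      by rewrite -defect_self; have [[_ ->] _] := Uh m I; rewrite linear0l.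
    by rewrite -codefect_self; have [_ [_ ->]] := Uh m I; rewrite linear0l.
  move=> [_ hD] m _; split; split=> //; apply: dot_injl => x; rewrite linear0l.
    by rewrite defect_self; apply: hD; exists m => //; left; exists x.
  by rewrite codefect_self; apply: hD; exists m => //; right; exists x.
exact: perp_closed_subspace.
Qed.

(** Contractivity is essential for the stability under [T]: if [h] is in the
    core, [T^m] preserves the norm of [T h], and a contraction that preserves
    the norm of a vector is inverted there by its adjoint
    ([adjoint_pair_isometric]). The other identity is algebraic, and the
    argument is symmetric in [T] and [T^*]. *)
Lemma core_biinvariant : biinvariant T (core T).
Proof.
have stable_iter (F G : H -> H) (h : H) : adjoint_pair F G ->
    (forall x, rnorm (F x) <= rnorm x) ->
    (forall m, iter m G (iter m F h) = h /\ iter m F (iter m G h) = h) ->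
    forall m, iter m G (iter m F (F h)) = F h /\ iter m F (iter m G (F h)) = F h.
  move=> FG Fle Uh m; split.
    apply: (adjoint_pair_isometric _ _ (adjoint_pair_iter _ _ FG m)).
      by move=> y; exact: iter_le.
    rewrite -iterSr (le_trans (Fle h))// -{1}(Uh m.+1).1.
    by apply: iter_le; exact: adjoint_pair_contraction FG Fle.
  case: m => [//|m]; rewrite [iter _ G _]iterSr iterS.
  by have /= -> := (Uh 1%N).1; rewrite (Uh m).2.
split=> [|h /unitary_partP[_ Uh]|h /unitary_partP[_ Uh]].
- exact: core_closed.
- by apply/unitary_partP; split=> //; exact: stable_iter.
- apply/unitary_partP; split=> // m.
  have AUh k : iter k T (iter k (adj T) h) = h /\ iter k (adj T) (iter k T h) = h.
    by have [] := Uh k.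
  by have [] := stable_iter _ _ _ AT A_le AUh m.
Qed.

Lemma biinvariant_defect M m x : biinvariant T M -> M x ->
  M (defect dot T m x) /\ M (codefect dot T m x).
Proof.
move=> [cM MT MA] Mx.
have iterM (F : H -> H) y : (forall z, M z -> M (F z)) -> M y -> M (iter m F y).
  by move=> MF My; elim: m => // k IHk; exact: MF.
split; apply: subspaceB => //.
  by apply: (iterM _ _ MA); exact: (iterM _ _ MT).
by apply: (iterM _ _ MT); exact: (iterM _ _ MA).
Qed.

(** The orthogonal projection onto [M] preserves the core, because the defect
    operators preserve [M] and its complement. *)
Lemma core_split M h p : biinvariant T M -> core T h -> M p -> perp M (h - p) ->
  core T p.
Proof.
move=> bM Uh Mp hp m _; have [[_ dh] [_ ch]] := Uh m I.
by split; split=> //; apply: (self_adjoint_split _ M h) => // x Mx;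
  have [] := biinvariant_defect M m x bM Mx.
Qed.

(** Follows from [core_split] as orthogonal projections are self-adjoint. *)
Lemma perp_core_split M h p : biinvariant T M -> perp (core T) h -> M p ->
  perp M (h - p) -> perp (core T) p.
Proof.
move=> bM [_ hU] Mp [_ hp]; split=> // u Uu.
have cM : closed_subspace M by case: bM.
have [q Mq uq] := orthogonal_projection M u cM.
have Uq : core T q by exact: (core_split M u).
rewrite -[u](subrK q) dotDr (dot_eq0C _ _ (uq p Mp)) add0r.
by rewrite -[p](subKr h) dotBl hU// hp// subrr.
Qed.

(** The defect operators are self-adjoint and preserve [M], so a vector of [M]
    orthogonal to their images of [M] is in all their kernels. *)
Lemma cnu_partE M : biinvariant T M -> cnu_part dot M T = M `&` perp (core T).
Proof.
move=> bM; have [cM MT MA] := bM.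
have dM m x : M x -> M (defect dot T m x).
  by move=> Mx; have [] := biinvariant_defect M m x bM Mx.
have cdM m x : M x -> M (codefect dot T m x).
  by move=> Mx; have [] := biinvariant_defect M m x bM Mx.
pose S := \bigcup_(m in [set: nat]) (defect dot T m @` M `|` codefect dot T m @` M).
have sub : cnu_part dot M T `<=` M `&` perp (core T).
  apply: smallest_sub.
    by apply: closed_subspaceI => //; exact: perp_closed_subspace.
  move=> _ [m _ [[x Mx <-]|[x Mx <-]]]; split; [exact: dM| |exact: cdM|].
    by split=> // y /(_ m I) [[_ yD] _]; rewrite defect_self yD linear0r.
  by split=> // y /(_ m I) [_ [_ yD]]; rewrite codefect_self yD linear0r.
apply/seteqP; split=> // x [Mx xU].
have cC : closed_subspace (cnu_part dot M T).
  split=> [N [[]]//|a u v Cu Cv N [cN SN]|].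
    by case: (cN) => _ Nl _; apply: Nl; [exact: Cu|exact: Cv].
  by apply: closed_bigI => N [[]].
have SC : S `<=` cnu_part dot M T by exact: sub_smallest.
have [p Cp xp] := orthogonal_projection _ x cC.
have [Mp [_ pU]] := sub p Cp.
have Mq : M (x - p) by exact: subspaceB.
suff Uq : core T (x - p).
  suff /subr0_eq -> : x - p = 0 by [].
  by apply: dot_eq0; rewrite dotBl xU.2// pU// subrr.
move=> m _; split; split=> //; apply: dot_eq0.
  by rewrite defect_self xp//; apply: SC; exists m => //; left;
    exists (defect dot T m (x - p)) => //; exact: dM.
by rewrite codefect_self xp//; apply: SC; exists m => //; right;
  exists (codefect dot T m (x - p)) => //; exact: cdM.
Qed.

Lemma biinvariant_adjoint_on M y : biinvariant T M -> M y ->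
  adjoint_on dot M T y = adj T y.
Proof. by move=> [cM _ MA] My; apply: adjoint_onE => //; exact: MA. Qed.

(** On a reducing subspace the adjoint of the restriction is the restriction of
    the adjoint, so unitarity on [M] says that [T^* T] and [T T^*] are the
    identity on [M]; then so are all [T^{*m} T^m] and [T^m T^{*m}]. *)
Lemma unitary_on_core M : biinvariant T M ->
  unitary_on dot M T <-> M `<=` core T.
Proof.
move=> bM; have [cM MT MA] := bM; split=> [[_ uM] h Mh|MU].
  have uA y : M y -> adj T (T y) = y /\ T (adj T y) = y.
    by move=> My; have := uM y My; rewrite !biinvariant_adjoint_on//; exact: MT.
  have iterE (F G : H -> H) m x : (forall y, M y -> M (F y)) ->
      (forall y, M y -> G (F y) = y) -> M x -> iter m G (iter m F x) = x.
    move=> MF GF; elim: m x => // m IHm x Mx.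
    by rewrite iterSr [iter m.+1 F x]iterSr -iterSr iterS IHm ?GF//; exact: MF.
  apply/unitary_partP; split=> // m; split; apply: iterE => // y My.
    by have [] := uA y My.
  by have [] := uA y My.
split=> [_ [x Mx <-]|h Mh]; first exact: MT.
rewrite !biinvariant_adjoint_on//; last exact: MT.
by have /unitary_partP[_ /(_ 1%N)] := MU h Mh.
Qed.

(** [M `&` core T] is a reducing subspace of [M] on which [T] is unitary. If it
    is trivial, then the projection onto [M] of any vector of the core, which
    stays in the core, is 0. *)
Lemma cnu_on_core M : biinvariant T M ->
  cnu_on dot M T <-> M `<=` perp (core T).
Proof.
move=> bM; have [cM MT MA] := bM; split=> [[_ cnuM] h Mh|MU].
  split=> // u Uu.
  have [p Mp up] := orthogonal_projection M u cM.
  have Up : core T p by exact: (core_split M u).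
  have bMU : biinvariant T (M `&` core T).
    by apply: biinvariantI => //; exact: core_biinvariant.
  have MU0 : M `&` core T = [set 0].
    apply: cnuM; first by apply/reduces_in_biinvariant; split=> // ? [].
    by apply/unitary_on_core => // ? [].
  have p0 : p = 0 by have : (M `&` core T) p by []; rewrite MU0.
  by apply/dot_eq0C; rewrite -(up h Mh) p0 subr0.
split.
  split=> [_ [x Mx <-]|x _]; first exact: MT.
  by case: cT => _; exact.
move=> N /(reduces_in_biinvariant _ _ bM)[bN NM] /(unitary_on_core _ bN) NU.
apply/seteqP; split=> [x Nx|_ ->]; last by case: bN => /subspace0.
by apply: dot_eq0; have [_] := MU x (NM x Nx); apply; exact: NU.
Qed.

End Contraction.

(** * The twist relations *)

(** Vectors of the core are the common fixed vectors of the operators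
    [T^{*m} T^m] and [T^m T^{*m}]. These are self-adjoint, so what commutes with
    [B] also commutes with its adjoint [B']. *)
Lemma core_stable T (B B' : H -> H) : contraction_on setT T ->
    adjoint_pair B B' ->
    (forall m x, iter m (adj T) (iter m T (B x)) = B (iter m (adj T) (iter m T x))) ->
    (forall m x, iter m T (iter m (adj T) (B x)) = B (iter m T (iter m (adj T) x))) ->
  (forall h, core T h -> core T (B h)) /\ (forall h, core T h -> core T (B' h)).
Proof.
move=> /adjointP TA BB' comm1 comm2; have AT := adjoint_pair_sym _ _ TA.
have TAm m := adjoint_pair_iter _ _ TA m; have ATm m := adjoint_pair_iter _ _ AT m.
split=> h /unitary_partP[_ Uh]; apply/unitary_partP; split=> // m.
  by rewrite comm1 comm2 (Uh m).1 (Uh m).2.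
split; apply: dot_injr => x.
  by rewrite -TAm -ATm -BB' -comm1 ATm TAm (Uh m).1 BB'.
by rewrite -ATm -TAm -BB' -comm2 TAm ATm (Uh m).2 BB'.
Qed.

(** [V] and [V'] are the twist and its inverse. They are plain functions so that
    the lemma applies both to [(T1, T2)] with [U] and to [(T2, T1)] with
    [adj U], which carries no bundled linear structure. *)
Lemma twisted_core T1 T2 (V V' : H -> H) :
    contraction_on setT T1 -> contraction_on setT T2 ->
    (forall x, T1 (T2 x) = V (T2 (T1 x))) ->
    (forall x, adj T1 (T2 x) = V' (T2 (adj T1 x))) ->
    (forall x, T1 (V x) = V (T1 x)) -> (forall x, T1 (V' x) = V' (T1 x)) ->
    (forall x, adj T1 (V x) = V (adj T1 x)) ->
    (forall x, adj T1 (V' x) = V' (adj T1 x)) ->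
    cancel V V' -> cancel V' V ->
  biinvariant T2 (core T1).
Proof.
move=> c1 c2 T12 A12 TV TV' AV AV' VK V'K.
have [] := core_stable T1 T2 (adj T2) c1 (adjointP T2 c2).
- by move=> m x; exact: (iter_untwist _ T1 (adj T1) T2 V V').
- by move=> m x; exact: (iter_untwist _ (adj T1) T1 T2 V' V).
- by split=> //; exact: core_closed.
Qed.

Lemma unitary_adjoint (U : {linear H -> H}) : unitary_on dot setT U ->
  [/\ contraction_on setT U, cancel U (adj U), cancel (adj U) U
    & adjoint_pair U (adj U)].
Proof.
move=> uU; have [_ UK] := uU.
have UA : adjoint_pair U (adj U).
  by move=> x y; have [_] := unitary_on_adjoint setT U y I uU I; exact.
split=> // [|x|x]; [|by have [] := UK x I|by have [] := UK x I].
split=> // x _; rewrite -(@ler_pXn2r _ 2)// ?nnegrE// !Hdot UA /adjoint.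
by have [-> _] := UK x I.
Qed.

(** For the exchanged pair, [T2 T1 = U^* T1 T2] follows by cancelling [U], and
    [T2^* T1 = U T1 T2^*] by taking adjoints in [T1^* T2 = U^* T2 T1^*]. Both
    use that [U] and [U^*] commute with all four operators. *)
Lemma doubly_twisted_core T1 T2 : doubly_twisted dot T1 T2 ->
  biinvariant T2 (core T1) /\ biinvariant T1 (core T2).
Proof.
move=> [c1 c2 [U [/unitary_adjoint[cU UK VK UV] [T12 A12 T1U T2U]]]].
pose V := adj U; rewrite -/V in UK VK UV A12.
have TA1 := adjointP T1 c1; have TA2 := adjointP T2 c2.
have VU := adjoint_pair_sym _ _ UV.
have comm_inv (F : H -> H) : (forall x, F (U x) = U (F x)) ->
    forall x, F (V x) = V (F x).
  by move=> FU x; rewrite -{2}[x]VK FU UK.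
have comm_adj (F G : H -> H) : adjoint_pair F G ->
    (forall x, F (U x) = U (F x)) ->
    (forall x, G (U x) = U (G x)) /\ (forall x, G (V x) = V (G x)).
  move=> FG FU; have GV y : G (V y) = V (G y).
    by apply: dot_injr => x; rewrite -FG -UV -FU FG UV.
  by split=> // y; apply: (can_inj VK); rewrite -GV !UK.
have [A1U A1V] := comm_adj _ _ TA1 T1U; have [A2U A2V] := comm_adj _ _ TA2 T2U.
have T1V := comm_inv _ T1U; have T2V := comm_inv _ T2U.
split; first exact: (twisted_core T1 T2 U V).
apply: (twisted_core T2 T1 V U) => // x.
  by rewrite T12 UK.
apply: dot_injr => y.
by rewrite -TA2 -(adjoint_pair_sym _ _ TA1) A12 VU TA2
  (adjoint_pair_sym _ _ TA1) A2U T1U.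
Qed.

(** * Comparison of orthogonal decompositions *)

(** [x - k = r] is in [M] and orthogonal to [M]. *)
Lemma component_eq M N x k r : closed_subspace M -> N `<=` M ->
  M x -> N k -> x = k + r -> (forall y, M y -> dot y r = 0) -> x = k.
Proof.
move=> cM NM Mx Nk xE Mr; apply: subr0_eq; apply: dot_eq0.
have rE : x - k = r by rewrite xE addrC addKr.
by rewrite {2}rE Mr//; apply: subspaceB => //; exact: NM.
Qed.

(** Decompose a vector of [M1] along the [N]s: its components in [N2], [N3] and
    [N4] are orthogonal to [M1], so it is its component in [N1]. *)
Lemma orthogonal_decomposition_eq (M1 M2 M3 M4 N1 N2 N3 N4 : set H) :
    orthogonal_decomposition dot M1 M2 M3 M4 ->
    orthogonal_decomposition dot N1 N2 N3 N4 ->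
    [/\ N1 `<=` M1, N2 `<=` M2, N3 `<=` M3 & N4 `<=` M4] ->
  [/\ N1 = M1, N2 = M2, N3 = M3 & N4 = M4].
Proof.
move=> [[c1 c2 c3 c4] [d12 d13 d14] [d23 d24 d34] _] [_ _ _ Nsum] [N1M N2M N3M N4M].
have d21 x y : M2 x -> M1 y -> dot x y = 0 by move=> ? ?; exact/dot_eq0C/d12.
have d31 x y : M3 x -> M1 y -> dot x y = 0 by move=> ? ?; exact/dot_eq0C/d13.
have d41 x y : M4 x -> M1 y -> dot x y = 0 by move=> ? ?; exact/dot_eq0C/d14.
have d32 x y : M3 x -> M2 y -> dot x y = 0 by move=> ? ?; exact/dot_eq0C/d23.
have d42 x y : M4 x -> M2 y -> dot x y = 0 by move=> ? ?; exact/dot_eq0C/d24.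
have d43 x y : M4 x -> M3 y -> dot x y = 0 by move=> ? ?; exact/dot_eq0C/d34.
split; apply/seteqP; split=> // x Mx;
  have [x1 [x2 [x3 [x4 [[n1 n2 n3 n4] xE]]]]] := Nsum x;
  have m1 := N1M _ n1; have m2 := N2M _ n2;
  have m3 := N3M _ n3; have m4 := N4M _ n4.
- suff -> : x = x1 by [].
  apply: (component_eq M1 N1 x x1 (x2 + x3 + x4)) => //.
    by rewrite xE -!addrA.
  by move=> y My; rewrite !dotDr d12// d13// d14// !addr0.
- suff -> : x = x2 by [].
  apply: (component_eq M2 N2 x x2 (x1 + x3 + x4)) => //.
    by rewrite xE (addrC x1) -!addrA.
  by move=> y My; rewrite !dotDr d21// d23// d24// !addr0.
- suff -> : x = x3 by [].
  apply: (component_eq M3 N3 x x3 (x1 + x2 + x4)) => //.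
    by rewrite xE (addrC _ x3) -!addrA.
  by move=> y My; rewrite !dotDr d31// d32// d34// !addr0.
- suff -> : x = x4 by [].
  apply: (component_eq M4 N4 x x4 (x1 + x2 + x3)) => //.
    by rewrite xE (addrC _ x4).
  by move=> y My; rewrite !dotDr d41// d42// d43// !addr0.
Qed.

Lemma perp_orthogonal M x y : M x -> perp M y -> dot x y = 0.
Proof. by move=> Mx [_ yM]; exact/dot_eq0C/yM. Qed.

End InnerProduct.

(** * The four-fold decomposition *)

Theorem theorem3p8 (R : realType) (H : completeNormedModType R[i])
    (dot : {dot H for Num.conj}) (Hdot : induces_norm dot)
    (T1 T2 : {linear H -> H}) (HT : doubly_twisted dot T1 T2) :
  let Hu1 := unitary_part dot setT T1 in
  let Hn1 := cnu_part dot setT T1 in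
  exists Huu Hun Hnu Hnn : set H,
    [/\ canonical_decomposition dot T1 T2 Huu Hun Hnu Hnn,
        (forall Kuu Kun Knu Knn : set H,
           canonical_decomposition dot T1 T2 Kuu Kun Knu Knn ->
           [/\ Kuu = Huu, Kun = Hun, Knu = Hnu & Knn = Hnn])
      & [/\ Huu = unitary_part dot Hu1 T2, Hun = cnu_part dot Hu1 T2,
            Hnu = unitary_part dot Hn1 T2 & Hnn = cnu_part dot Hn1 T2]].
Proof.
move=> Hu1 Hn1.
have [c1 c2 _] := HT.
have [b21 b12] := doubly_twisted_core dot Hdot T1 T2 HT.
have b11 := core_biinvariant dot Hdot T1 c1.
have b22 := core_biinvariant dot Hdot T2 c2.
pose U1 := unitary_part dot setT T1; pose U2 := unitary_part dot setT T2.
pose P1 := orthocompl_in dot setT U1; pose P2 := orthocompl_in dot setT U2.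
have p11 : biinvariant dot T1 P1 := perp_biinvariant dot Hdot T1 c1 _ b11.
have p21 : biinvariant dot T2 P1 := perp_biinvariant dot Hdot T2 c2 _ b21.
have p12 : biinvariant dot T1 P2 := perp_biinvariant dot Hdot T1 c1 _ b12.
have p22 : biinvariant dot T2 P2 := perp_biinvariant dot Hdot T2 c2 _ b22.
have Hn1E : Hn1 = P1.
  by rewrite /Hn1 (cnu_partE dot Hdot _ c1) ?setTI//; exact: biinvariantT.
have [cU1 _ _] := b11; have [cU2 _ _] := b22.
have [cP1 _ _] := p11; have [cP2 _ _] := p22.
have UP (M : set H) := perp_orthogonal dot M.
(* project [h] onto [U1], then both components onto [U2] *)
have dec : orthogonal_decomposition dot
    (U1 `&` U2) (U1 `&` P2) (P1 `&` U2) (P1 `&` P2).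
  split.
  - by split; exact: closed_subspaceI.
  - split=> x y [x1 x2] [y1 y2]; [exact: (UP U2)|exact: (UP U1)|exact: (UP U1)].
  - split=> x y [x1 x2] [y1 y2]; [exact: (UP U1)|exact: (UP U1)|exact: (UP U2)].
  move=> h.
  have [a Ua ha] := orthogonal_projection dot Hdot U1 h cU1.
  have P1ha : P1 (h - a) by split.
  have [b Ub ab] := orthogonal_projection dot Hdot U2 a cU2.
  have [d Ud had] := orthogonal_projection dot Hdot U2 (h - a) cU2.
  have U1b : U1 b by exact: (core_split dot Hdot T1 c1 U2 a).
  have P1d : P1 d by exact: (perp_core_split dot Hdot T1 c1 U2 (h - a)).
  exists b, (a - b), d, (h - a - d); split; last first.
    by rewrite (addrC b) subrK -addrA (addrC d) subrK addrC subrK.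
  have P2ab : P2 (a - b) by split.
  have P2had : P2 (h - a - d) by split.
  have U1ab : U1 (a - b) := subspaceB U1 cU1 a b Ua U1b.
  have P1had : P1 (h - a - d) := subspaceB P1 cP1 (h - a) d P1ha P1d.
  by split.
exists (U1 `&` U2), (U1 `&` P2), (P1 `&` U2), (P1 `&` P2); split.
- split=> //.
    by split; split; apply/(reducesP dot Hdot) => //; exact: biinvariantI.
  split; split; (apply/(unitary_on_core dot Hdot) || apply/(cnu_on_core dot Hdot)) => //;
    (exact: biinvariantI || by move=> x []).
- move=> Kuu Kun Knu Knn [Kdec [[r1 r2] [r3 r4] [r5 r6] [r7 r8]]
    [[u1 u2] [u3 n4] [n5 u6] [n7 n8]]].
  apply: (orthogonal_decomposition_eq dot _ _ _ _ _ _ _ _ dec Kdec) => //.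
  have inU T K : contraction_on setT T -> reduces dot T K ->
      unitary_on dot K T -> K `<=` unitary_part dot setT T.
    by move=> c /(reducesP _ Hdot _ c) bK /(unitary_on_core _ Hdot _ c _ bK).
  have inP T K : contraction_on setT T -> reduces dot T K ->
      cnu_on dot K T -> K `<=` orthocompl_in dot setT (unitary_part dot setT T).
    by move=> c /(reducesP _ Hdot _ c) bK /(cnu_on_core _ Hdot _ c _ bK).
  by split; rewrite subsetI; split; (exact: inU || exact: inP).
- rewrite Hn1E -!(cnu_partE _ Hdot _ c2)// -!unitary_partE.
  by split.
Qed.
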